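(* Let $l^{(2)}(t)$ and $u^{(2)}(t)$ be functions (values $\pm\infty$ allowed) such that $l^{(2)}(t)\le m^{(2)}_{\lambda}(t)\le u^{(2)}(t)$ for all $\lambda\ge 0$ and any $t$. Let $\psi:\mathbb{R}\to\mathbb{R}$ and let $\delta_{\psi}(\mathbf{X})=X_2-\psi(D)$ be a location equivariant estimator of $\theta_2$ such that $P_{\boldsymbol\theta}[l^{(2)}(D)\le\psi(D)\le u^{(2)}(D)]<1$ for all $\boldsymbol\theta\in\Theta_0$. Let $\psi_{2,0}:\mathbb{R}\to\mathbb{R}$ be such that $\psi(t)<\psi_{2,0}(t)\le l^{(2)}(t)$ whenever $\psi(t)<l^{(2)}(t)$; $u^{(2)}(t)\le\psi_{2,0}(t)<\psi(t)$ whenever $u^{(2)}(t)<\psi(t)$; and $\psi_{2,0}(t)=\psi(t)$ whenever $l^{(2)}(t)\le\psi(t)\le u^{(2)}(t)$. Let $\delta_{\psi_{2,0}}(\mathbf{X})=X_2-\psi_{2,0}(D)$. Then $GPN(\delta_{\psi_{2,0}},\delta_{\psi};\boldsymbol\theta)>\frac12$ for all $\boldsymbol\theta\in\Theta_0$.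
   Context: $f$ is a specified Lebesgue probability density on $\mathbb{R}^2$, and $\mathbf{X}=(X_1,X_2)$ has joint p.d.f. $f(x_1-\theta_1,x_2-\theta_2)$, where $\boldsymbol\theta=(\theta_1,\theta_2)\in\Theta_0=\{(t_1,t_2)\in\mathbb{R}^2: t_1\le t_2\}$ is unknown. Put $\lambda=\theta_2-\theta_1\ge 0$, $D=X_2-X_1$, $Z_2=X_2-\theta_2$. The p.d.f. of $D$ is $f_D(t|\lambda)=\int_{-\infty}^{\infty}f(y-t+\lambda,y)\,dy$, and the conditional p.d.f. of $Z_2$ given $D=t$ is $f_\lambda(s|t)=f(s-t+\lambda,s)/f_D(t|\lambda)$ ($t$ in the support of $D$). $m^{(2)}_\lambda(t)$ denotes the median of this conditional distribution, so $\int_{-\infty}^{m^{(2)}_\lambda(t)}f(s-t+\lambda,s)\,ds=\frac12\int_{-\infty}^{\infty}f(s-t+\lambda,s)\,ds$. General loss function: $L_2(\boldsymbol\theta,a)=W(a-\theta_2)$, $a\in\mathbb{R}$, where $W:\mathbb{R}\to[0,\infty)$ satisfies $W(0)=0$, $W$ strictly decreasing on $(-\infty,0)$ and strictly increasing on $(0,\infty)$. For estimators $\delta_1,\delta_2$ of $\theta_2$, $GPN(\delta_1,\delta_2;\boldsymbol\theta)=P_{\boldsymbol\theta}[L_2(\boldsymbol\theta,\delta_1)<L_2(\boldsymbol\theta,\delta_2)]+\frac12P_{\boldsymbol\theta}[L_2(\boldsymbol\theta,\delta_1)=L_2(\boldsymbol\theta,\delta_2)]$. All functions defining estimators are understood to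 be Borel measurable.
   Formalization: The formal theorem also assumes that the one-sided limits of W at 0 are equal; without this the GPN can equal exactly 1/2. If the conditional median is not unique, the bounds l and u are required to hold for every median. *)

(* Defs.v *)
(* Uses MathComp and MathComp-Analysis. *)
From HB Require Import structures.
From mathcomp Require Import all_boot all_order all_algebra.
From mathcomp Require Import all_classical all_reals all_analysis.

Set Implicit Arguments.
Unset Strict Implicit.
Unset Printing Implicit Defensive.

Import Order.TTheory GRing.Theory Num.Theory.
Import numFieldNormedType.Exports.
Local Open Scope classical_set_scope.
Local Open Scope ring_scope.

Section Model.
Context {R : realType}.

Definition leb2 : set (R * R) -> \bar R :=
  (@lebesgue_measure R \x @lebesgue_measure R)%E.

Definition is_pdf2 (f : R * R -> R) : Prop :=
  [/\ measurable_fun [set: R * R] f,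
      forall x, 0 <= f x
    & (\int[leb2]_x (f x)%:E = 1)%E].

Definition Theta0 : set (R * R) := [set th | th.1 <= th.2].

(* The observation X is a fixed random vector on a sample space T; only the
   probability P th depends on the parameter. *)
Definition location_model (f : R * R -> R) d (T : measurableType d)
    (P : R * R -> probability T R) (X : T -> R * R) : Prop :=
  measurable_fun [set: T] X /\
  forall th, Theta0 th -> forall B : set (R * R), measurable B ->
    P th (X @^-1` B) =
    (\int[leb2]_(x in B) (f (x.1 - th.1, x.2 - th.2))%:E)%E.

Definition D (x : R * R) : R := x.2 - x.1.

Definition pdfD (f : R * R -> R) (lam t : R) : \bar R :=
  (\int[lebesgue_measure]_y (f (y - t + lam, y))%:E)%E.

(* The points t at which the conditional density given D = t is defined.  The
   value +oo is possible, but only for t in a Lebesgue-null set. *)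
Definition suppD (f : R * R -> R) (lam : R) : set R :=
  [set t | (0 < pdfD f lam t < +oo)%E].

Definition cond_pdf (f : R * R -> R) (lam t s : R) : R :=
  f (s - t + lam, s) / fine (pdfD f lam t).

(* m is a median of the distribution with density g; it need not be unique. *)
Definition is_median (g : R -> R) (m : R) : Prop :=
  (\int[lebesgue_measure]_(s in `]-oo, m]) (g s)%:E = (2^-1)%:E)%E.

(* When the conditional median m is not unique, the bounds are required for
   each of its values. *)
Definition median_bounds (f : R * R -> R) (l u : R -> \bar R) : Prop :=
  forall lam t m : R, 0 <= lam -> suppD f lam t ->
    is_median (cond_pdf f lam t) m -> (l t <= m%:E <= u t)%E.

Definition bowl_shaped (W : R -> R) : Prop :=
  [/\ forall x, 0 <= W x,
      W 0 = 0,
      forall x y, x < y -> y < 0 -> W y < W x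
    & forall x y, 0 < x -> x < y -> W x < W y].

Definition L2 (W : R -> R) (th : R * R) (a : R) : R := W (a - th.2).

Definition equivariant_est (psi : R -> R) (x : R * R) : R := x.2 - psi (D x).

Definition GPN (W : R -> R) d (T : measurableType d)
    (P : R * R -> probability T R) (X : T -> R * R)
    (delta1 delta2 : R * R -> R) (th : R * R) : \bar R :=
  (P th [set w | L2 W th (delta1 (X w)) < L2 W th (delta2 (X w))]%R +
   (2^-1)%:E *
   P th [set w | L2 W th (delta1 (X w)) = L2 W th (delta2 (X w))])%E.

End Model.

(* Main.v *)
(* In the coordinates t = D, s = X2 - theta2, the density is f(s - t + lam, s)
   (a shear, by Tonelli and the invariance of Lebesgue measure).  Fix t with
   psi t < l t, so psi t < psi0 t <= every conditional median.  Since the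
   one-sided limits of W at 0 agree, psi0 beats psi for all s > b, for some
   b < psi0 t.  If at least half the conditional mass lay in ]-oo, b], the
   continuous conditional distribution function would take the value 1/2 at
   some point <= b < psi0 t, contradicting the bound on medians; so psi0 wins
   with conditional probability > 1/2.  The case u t < psi t is symmetric, and
   elsewhere the two estimators coincide.  Integrating over t keeps the
   inequality strict because P(psi0(D) <> psi(D)) > 0. *)
Require Import Defs.
From HB Require Import structures.
From mathcomp Require Import all_boot all_order all_algebra.
From mathcomp Require Import all_classical all_reals all_analysis.
From mathcomp Require Import measurable_realfun ring lra.
Import Order.TTheory GRing.Theory Num.Theory.
Import numFieldNormedType.Exports.
Local Open Scope classical_set_scope.
Local Open Scope ring_scope.

(** * Invariance of Lebesgue measure under translation and reflection *)

Lemma preimage_addr_itv (R : numDomainType) (c a b : R) :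
  (fun x => x + c) @^-1` `]a, b] = `]a - c, b - c]%classic.
Proof.
by apply/seteqP; split => x /=; rewrite !in_itv/= ltrBlDr lerBrDr.
Qed.

Lemma measurable_addr (R : realType) (c : R) :
  measurable_fun [set: R] (fun x => x + c).
Proof. exact: measurable_funD. Qed.

(** Lebesgue measure is determined by its values on half-open intervals, and a translation preserves
    their lengths. *)
Lemma lebesgue_measureD (R : realType) (c : R) (A : set R) : measurable A ->
  pushforward lebesgue_measure
    ((fun x => x + c) : measurableTypeR R -> measurableTypeR R) A =
  lebesgue_measure A.
Proof.
move=> mA; apply/esym.
pose g : {mfun measurableTypeR R >-> measurableTypeR R} :=
  HB.pack ((fun x => x + c) : measurableTypeR R -> measurableTypeR R)
    (isMeasurableFun.Build _ _ (measurableTypeR R) (measurableTypeR R) _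
      (measurable_addr R c)).
rewrite (_ : pushforward _ _ = pushforward (@lebesgue_measure R) g)//.
apply: lebesgue_measure_unique => //= _ [[a b]] _ <-.
rewrite /pushforward /= preimage_addr_itv !lebesgue_measure_itv/= !lte_fin.
rewrite ltrD2r; case: ifP => _ //; congr (_%:E); ring.
Qed.

Lemma ge0_integral_translate (R : realType) (c : R) (f : R -> \bar R) :
  measurable_fun [set: R] f -> (forall x, 0 <= f x)%E ->
  (\int[lebesgue_measure]_x f (x + c)%R = \int[lebesgue_measure]_x f x)%E.
Proof.
move=> mf f0.
rewrite [RHS](eq_measure_integral (pushforward lebesgue_measure
    ((fun x => x + c) : measurableTypeR R -> measurableTypeR R))).
- exact: measurable_addr.
- by move=> mD; rewrite ge0_integral_pushforward.
- by move=> mD A mA _; rewrite [RHS]lebesgue_measureD.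
Qed.

Lemma ge0_integral_reflect (R : realType) (c : R) (f : R -> \bar R) :
  measurable_fun [set: R] f -> (forall x, 0 <= f x)%E ->
  (\int[lebesgue_measure]_x f (c - x)%R = \int[lebesgue_measure]_x f x)%E.
Proof.
move=> mf f0; rewrite -[RHS](ge0_integral_translate R c)//.
have mfc : measurable_fun [set: R] (fun x => f (x + c)).
  by apply: measurableT_comp => //; exact: measurable_addr.
rewrite [RHS](eq_measure_integral (pushforward lebesgue_measure
    (-%R : measurableTypeR R -> measurableTypeR R))); last first.
  by move=> A mA _; exact/esym/lebesgue_measureN.
rewrite ge0_integral_pushforward//=.
by apply: eq_integral => x _ /=; rewrite addrC.
Qed.

(** * Tonelli's theorem and the shear of the plane *)

(* [R * R] carries two provably equal product structures, one built from the
   canonical measurable structure of [R] and one from [measurableTypeR R], the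
   domain of [lebesgue_measure]; Tonelli's theorem only applies to the latter. *)
Lemma measurable_fun_prodR (R : realType) d (U : measurableType d)
    (k : R * R -> U) :
  measurable_fun [set: R * R] k ->
  measurable_fun [set: measurableTypeR R * measurableTypeR R] k.
Proof.
move=> mk.
have mid : measurable_fun [set: measurableTypeR R * measurableTypeR R]
    (fun x => (x.1, x.2) : R * R).
  apply/measurable_fun_pair.
  - exact: (@measurable_fst _ _ (measurableTypeR R) (measurableTypeR R)).
  - exact: (@measurable_snd _ _ (measurableTypeR R) (measurableTypeR R)).
rewrite [k](_ : _ = k \o (fun x => (x.1, x.2) : R * R)).
  exact: measurableT_comp.
by apply/funext => -[].
Qed.

Lemma ge0_integral_leb2 (R : realType) (B : set (R * R)) (k : R * R -> \bar R) :
  measurable B -> measurable_fun [set: R * R] k -> (forall x, 0 <= k x)%E ->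
  (\int[leb2]_(x in B) k x =
   \int[lebesgue_measure]_y \int[lebesgue_measure]_x (k \_ B) (x, y))%E.
Proof.
move=> mB mk k0.
(* The identity, seen as a map between the two product structures: pushing forward along it moves
   the integral against [leb2] to the structure where Tonelli applies. *)
pose phi : measurableTypeR R * measurableTypeR R -> R * R := id.
have mphi : measurable_fun setT phi.
  by apply: (measurable_fun_prodR R _ _ id); exact: measurable_id.
have := ge0_integral_pushforward mphi
  (@lebesgue_measure R \x @lebesgue_measure R)%E mB (measurable_funTS mk)
  (fun x _ => k0 x).
rewrite /pushforward [X in _ = X -> _]integral_mkcond.
rewrite (@fubini_tonelli2 _ _ _ _ _ (@lebesgue_measure R)
  (@lebesgue_measure R) ((k \o phi) \_ (phi @^-1` B)))//.
- apply: (measurable_fun_prodR R _ _ (k \_ B)).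
  exact/(measurable_restrictT _ mB)/measurable_funTS.
- by move=> x; rewrite patchE; case: ifP.
Qed.

Lemma measurable_integral_snd (R : realType) (k : R * R -> \bar R) :
  measurable_fun [set: R * R] k -> (forall x, 0 <= k x)%E ->
  measurable_fun [set: R] (fun t => \int[lebesgue_measure]_s k (t, s))%E.
Proof.
move=> mk k0.
exact: (@measurable_fun_fubini_tonelli_F _ _ _ _ _ (@lebesgue_measure R) k
  (measurable_fun_prodR R _ _ k mk)).
Qed.

(** Translate the ordinate, [y = s + c], swap the integrals, and for fixed [s] reflect the abscissa,
    [x = s + c - t]. With [c] equal to theta2, the new coordinates [t] and [s] are D and X2 -
    theta2. *)
Lemma ge0_integral_shear (R : realType) (c : R) (B : set (R * R))
    (k : R * R -> \bar R) :
  measurable B -> measurable_fun [set: R * R] k -> (forall x, 0 <= k x)%E ->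
  (\int[leb2]_(x in B) k x =
   \int[lebesgue_measure]_t \int[lebesgue_measure]_s
     (k \_ B) (s + c - t, s + c)%R)%E.
Proof.
move=> mB mk k0; rewrite ge0_integral_leb2//.
have mkB : measurable_fun [set: R * R] (k \_ B).
  exact/(measurable_restrictT _ mB)/measurable_funTS.
have kB0 x : (0 <= (k \_ B) x)%E by rewrite patchE; case: ifP.
rewrite -(ge0_integral_translate R c); first last.
- by move=> x; exact: integral_ge0.
- exact: (@measurable_fun_fubini_tonelli_G _ _ _ _ _ (@lebesgue_measure R)
    (k \_ B) (measurable_fun_prodR R _ _ (k \_ B) mkB)).
rewrite [RHS](@fubini_tonelli _ _ _ _ _ (@lebesgue_measure R)
  (@lebesgue_measure R) (fun p => (k \_ B) (p.2 + c - p.1, p.2 + c)))//=;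
  last first.
  apply: measurable_fun_prodR; apply: measurableT_comp => //.
  apply/measurable_fun_pair => /=.
    by apply: measurable_funB => //; exact: measurable_funD.
  exact: measurable_funD.
apply: eq_integral => s _ /=.
rewrite (ge0_integral_reflect R (s + c) (fun x => (k \_ B) (x, s + c)))//.
by apply: measurableT_comp => //; exact: measurable_fun_pair.
Qed.

(** * Bowl-shaped losses *)

(** The set where [W < c] is an interval, since [W] falls towards its value at 0 from either side;
    its complement is the preimage of a generator of the Borel sets. *)
Lemma bowl_shaped_measurable (R : realType) (W : R -> R) :
  bowl_shaped W -> measurable_fun [set: R] W.
Proof.
case=> W0 W00 Wneg Wpos mD.
apply: (measurability _ (RGenCInfty.measurableE R)) => // _ [_ [c ->] <-].
rewrite setTI -[X in measurable X]setCK; apply: measurableC.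
apply: is_interval_measurable => x y /= Hx Hy z /andP[xz zy].
move: Hx Hy; rewrite !in_itv/= !andbT => /negP + /negP.
rewrite -!ltNge => Wx Wy; apply/negP; rewrite -ltNge.
case: (ltrgtP z 0) => [z0|z0|->].
- move: xz; rewrite le_eqVlt => /predU1P[<-//|xz].
  exact: lt_trans (Wneg _ _ xz z0) Wx.
- move: zy; rewrite le_eqVlt => /predU1P[->//|zy].
  exact: lt_trans (Wpos _ _ z0 zy) Wy.
- by rewrite W00; apply: le_lt_trans Wx.
Qed.

Lemma bowl_shaped_gt0 (R : realType) (W : R -> R) (v : R) :
  bowl_shaped W -> v != 0 -> 0 < W v.
Proof.
case=> W0 W00 Wneg Wpos; rewrite neq_lt => /orP[v0|v0].
- by apply: le_lt_trans (W0 (v / 2)) _; apply: Wneg; lra.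
- by apply: le_lt_trans (W0 (v / 2)) _; apply: Wpos; lra.
Qed.

(* Since the one-sided limits of [W] at 0 agree, both lie strictly below
   every [W v] with [v != 0]. *)
Lemma bowl_shaped_near0 (R : realType) (W : R -> R) (v : R) :
  bowl_shaped W -> cvg (W x @[x --> (0 : R)^']) -> v != 0 ->
  exists2 e, 0 < e & forall y, `|y| < e -> W y < W v.
Proof.
move=> bW cW v0; have [W0 W00 Wneg Wpos] := bW.
set c := lim (W x @[x --> (0 : R)^']) in cW.
have cv : c < W v.
  have [v_lt0|v_gt0|] := ltgtP v 0; last by move/eqP; rewrite (negbTE v0).
  (* Passing to the limit only gives a weak inequality; the midpoint [v / 2] supplies the
     strictness. *)
  - apply: (@le_lt_trans _ _ (W (v / 2))); last by apply: Wneg; lra.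
    apply: (@cvgr_to_le _ _ (at_left_proper_filter _) _ _ _ _
      (cvg_dnbhs_at_left cW)).
    near=> x; apply: ltW; apply: Wneg; near: x.
    + by apply: nbhs_left_gt; lra.
    + exact: nbhs_left_lt.
  - apply: (@le_lt_trans _ _ (W (v / 2))); last by apply: Wpos; lra.
    apply: (@cvgr_to_le _ _ (at_right_proper_filter _) _ _ _ _
      (cvg_dnbhs_at_right cW)).
    near=> x; apply: ltW; apply: Wpos; near: x.
    + exact: nbhs_right_gt.
    + by apply: nbhs_right_lt; lra.
have : \forall x \near (0 : R)^', W x < W v.
  exact: (cvgr_lt c).
move=> /nbhs_ballP[e /= e0 He].
exists e => // y ye; have [->|y0] := eqVneq y 0.
  by rewrite W00; exact: bowl_shaped_gt0.
by apply: He => //; rewrite /ball/= sub0r normrN.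
Unshelve. all: by end_near. Qed.

(** * Distribution functions, medians and tails of a density *)

(** Prepares the intermediate value theorem at level 1/2. Continuity is absolute continuity of the
    integral. Some interval from [-n] to [n] carries mass above 1/2; as [F] stays between 0 and 1,
    this forces [F n > 1/2] and [F (-n) < 1/2]. *)
Lemma density_cdf (R : realType) (g : R -> R) :
  measurable_fun [set: R] g -> (forall x, 0 <= g x) ->
  (\int[lebesgue_measure]_x (g x)%:E = 1)%E ->
  exists F : R -> R,
    [/\ continuous F,
        forall x, (\int[lebesgue_measure]_(s in `]-oo, x]) (g s)%:E = (F x)%:E)%E,
        exists x, F x < 2^-1 & exists x, 2^-1 < F x].
Proof.
move=> mg g0 g1.
have mgE (A : set R) : measurable_fun A (EFin \o g).
  by apply/measurable_EFinP; apply: measurable_funS mg.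
have gE0 x : (0 <= (EFin \o g) x)%E by rewrite lee_fin.
have ig : lebesgue_measure.-integrable [set: R] (EFin \o g).
  apply/integrableP; split; first exact: mgE.
  under eq_integral do rewrite gee0_abs//.
  by rewrite [ltLHS]g1 ltry.
have igA (A : set R) : measurable A -> lebesgue_measure.-integrable A (EFin \o g).
  by move=> mA; apply: integrableS ig.
pose F x := fine (\int[lebesgue_measure]_(s in `]-oo, x]) (g s)%:E).
have FE x : (\int[lebesgue_measure]_(s in `]-oo, x]) (g s)%:E = (F x)%:E)%E.
  by rewrite fineK//; apply: integrable_fin_num => //; exact: igA.
have FB x y : x <= y -> F y - F x = \int[lebesgue_measure]_(s in `]x, y]) g s.
  move=> xy; rewrite /Rintegral.
  have : (\int[lebesgue_measure]_(s in `]-oo, y]) (g s)%:E = 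
     \int[lebesgue_measure]_(s in `]-oo, x]) (g s)%:E + \int[lebesgue_measure]_(s in `]x, y]) (g s)%:E)%E.
    have -> : `]-oo, y]%classic = `]-oo, x]%classic `|` `]x, y]%classic.
      by rewrite -(@itv_bndbnd_setU _ _ -oo%O (BRight x) (BRight y)).
    rewrite ge0_integral_setU//=.
    - exact: mgE.
    - by move=> z _; rewrite lee_fin.
    - rewrite disj_set2E; apply/eqP; rewrite -subset0 => z [] /=.
      by rewrite !in_itv/= => zx /andP[]; rewrite ltNge zx.
  rewrite !FE => /(congr1 (fun z => z - (F x)%:E)%E).
  rewrite addeAC subee// add0e => <-.
  by rewrite -EFinB.
have F_cts : continuous F.
  move=> x; apply/cvgrPdist_lt => e e0.
  have [d [d0 Hd]] := integral_normr_continuous ig e0.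
  exists d => //= y /=; rewrite /ball/= => xyd.
  wlog xy : x y xyd / x <= y.
    move=> H; have [xy|yx] := leP x y; first exact: H.
    by rewrite distrC; apply: H (ltW yx); rewrite // distrC.
  rewrite distrC FB//.
  rewrite ger0_norm; last by apply: Rintegral_ge0.
  under eq_Rintegral do rewrite -[g _]ger0_norm//.
  apply: Hd => //.
  rewrite [ltLHS](lebesgue_measure_itv `]x, y])/= lte_fin; case: ifP => // _.
  by rewrite -EFinB lte_fin; move: xyd; rewrite distrC ger0_norm// subr_ge0.
have [n Hn] : exists n : nat, 2^-1 < F n%:R - F (- n%:R).
  have : (fun k : nat =>
      \int[lebesgue_measure]_(s in `](- k%:R)%R, k%:R%R]) (g s)%:E)%E @ \oo --> 1%E.
    rewrite -g1 -(bigcup_itvT false false).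
    apply: ge0_nondecreasing_set_cvg_integral => //.
    - apply/nondecreasing_seqP => n; rewrite subsetEset => z /=.
      by rewrite !in_itv/= -natr1; lra.
    - by move=> n; exact: mgE.
    - by move=> n z _; exact: gE0.
  (* If all these intervals had mass at most 1/2, so would their limit, the total mass 1. *)
  move=> cv1; apply: contrapT => Hex.
  suff : (1 <= (2^-1)%:E :> \bar R)%E by rewrite lee_fin; lra.
  apply: (cvge_to_le cv1); near=> n.
  rewrite leNgt; apply/negP => ltn; apply: Hex; exists n; move: ltn.
  have nn : - n%:R <= n%:R :> R by have := ler0n R n; lra.
  rewrite -[X in (_ < X)%E]fineK; last by apply: integrable_fin_num => //; exact: igA.
  rewrite lte_fin.
  by rewrite -[fine _]/(\int[lebesgue_measure]_(s in `]- n%:R, n%:R]) g s) -FB.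
have F0 x : 0 <= F x by apply: fine_ge0; apply: integral_ge0 => z _; exact: gE0.
have F1 x : F x <= 1.
  rewrite -lee_fin -FE -g1; apply: ge0_subset_integral => //.
  - exact: mgE.
  - by move=> z _; exact: gE0.
exists F; split => //.
- by exists (- n%:R); have := F1 n%:R; lra.
- by exists n%:R; have := F0 (- n%:R); lra.
Unshelve. all: by end_near. Qed.

(** Intermediate value theorem between [a] and a point where the distribution function is below 1/2;
    monotonicity puts that point to the left of [a]. Bounds imposed on every median can then be
    tested on the one found here. *)
Lemma median_le (R : realType) (g : R -> R) (a : R) :
  measurable_fun [set: R] g -> (forall x, 0 <= g x) ->
  (\int[lebesgue_measure]_x (g x)%:E = 1)%E ->
  ((2^-1)%:E <= \int[lebesgue_measure]_(s in `]-oo, a]) (g s)%:E)%E ->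
  exists2 m, m <= a & is_median g m.
Proof.
move=> mg g0 g1; have [F [cF FE [x Fx] _]] := density_cdf R g mg g0 g1.
rewrite FE lee_fin => Fa.
have [xa|ax] := leP x a.
- have [||m] := @IVT _ F x a 2^-1 xa.
  + exact: continuous_subspaceT.
  + by rewrite ge_min le_max (ltW Fx) Fa orbT.
  by rewrite in_itv/= => /andP[_ ma] Fm; exists m => //; rewrite /is_median FE Fm.
- exfalso; have : ((F a)%:E <= (F x)%:E)%E.
    rewrite -!FE; apply: ge0_subset_integral => //.
    + by apply/measurable_EFinP; apply: measurable_funS mg.
    + by move=> z _; rewrite lee_fin.
    + by move=> z /=; rewrite !in_itv/= => /le_trans; apply; exact: ltW.
  by rewrite lee_fin; lra.
Qed.

Lemma median_ge (R : realType) (g : R -> R) (a : R) :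
  measurable_fun [set: R] g -> (forall x, 0 <= g x) ->
  (\int[lebesgue_measure]_x (g x)%:E = 1)%E ->
  (\int[lebesgue_measure]_(s in `]-oo, a]) (g s)%:E <= (2^-1)%:E)%E ->
  exists2 m, a <= m & is_median g m.
Proof.
move=> mg g0 g1; have [F [cF FE _ [x Fx]]] := density_cdf R g mg g0 g1.
rewrite FE lee_fin => Fa.
have [ax|xa] := leP a x.
- have [||m] := @IVT _ F a x 2^-1 ax.
  + exact: continuous_subspaceT.
  + by rewrite ge_min le_max (ltW Fx) Fa orbT.
  by rewrite in_itv/= => /andP[am _] Fm; exists m => //; rewrite /is_median FE Fm.
- exfalso; have : ((F x)%:E <= (F a)%:E)%E.
    rewrite -!FE; apply: ge0_subset_integral => //.
    + by apply/measurable_EFinP; apply: measurable_funS mg.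
    + by move=> z _; rewrite lee_fin.
    + by move=> z /=; rewrite !in_itv/= => /le_trans; apply; exact: ltW.
  by rewrite lee_fin; lra.
Qed.

(** Writes both unnormalised tails in terms of the normalised mass [p] of the lower one, so that
    comparing the tails amounts to comparing [p] with 1/2. *)
Lemma normalized_tails (R : realType) (phi : R -> R) (b : R) :
  measurable_fun [set: R] phi -> (forall x, 0 <= phi x) ->
  let c := (\int[lebesgue_measure]_x (phi x)%:E)%E in
  (0 < c < +oo)%E ->
  let g := fun s => phi s / fine c in
  [/\ measurable_fun [set: R] g, forall x, 0 <= g x,
      (\int[lebesgue_measure]_x (g x)%:E = 1)%E &
      exists p : R,
       [/\ (\int[lebesgue_measure]_(s in `]-oo, b]) (g s)%:E = p%:E)%E,
           (\int[lebesgue_measure]_(s in `]-oo, b]) (phi s)%:E =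
             (fine c * p)%:E)%E &
           (\int[lebesgue_measure]_(s in `]b, +oo[) (phi s)%:E =
             (fine c * (1 - p))%:E)%E]].
Proof.
move=> mphi phi0 c c_fin g.
have cE : c = (fine c)%:E by rewrite fineK// gt0_fin_numE; case/andP: c_fin.
have c_gt0 : 0 < fine c by rewrite fine_gt0.
have mphiE (A : set R) : measurable_fun A (EFin \o phi).
  by apply/measurable_EFinP; apply: measurable_funS mphi.
have mg : measurable_fun [set: R] g by apply: measurable_funM.
have g0 x : 0 <= g x by rewrite divr_ge0// ltW.
have mgE (A : set R) : measurable_fun A (EFin \o g).
  by apply/measurable_EFinP; apply: measurable_funS mg.
have phiE (A : set R) : measurable A ->
    (\int[lebesgue_measure]_(s in A) (phi s)%:E =
     (fine c)%:E * \int[lebesgue_measure]_(s in A) (g s)%:E)%E.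
  move=> mA; rewrite -ge0_integralZl//; first last.
  - by rewrite lee_fin ltW.
  - by move=> x _; rewrite lee_fin.
  - exact: mgE.
  apply: eq_integral => x _; rewrite -EFinM; congr (_%:E).
  by rewrite /g mulrC divfK// gt_eqF.
have g1 : (\int[lebesgue_measure]_x (g x)%:E = 1)%E.
  have := phiE [set: R] measurableT; rewrite -/c {1}cE => /esym.
  move=> /(congr1 (fun z => (fine c)^-1%:E * z)%E).
  by rewrite muleA -!EFinM mulVf ?mul1e// gt_eqF.
split => //.
have cupE : `]-oo, b]%classic `|` `]b, +oo[%classic = [set: R].
  by rewrite -setCitvl setUv.
have g_split : (\int[lebesgue_measure]_(s in `]-oo, b]) (g s)%:E +
    \int[lebesgue_measure]_(s in `]b, +oo[) (g s)%:E = 1)%E.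
  rewrite -ge0_integral_setU//= ?cupE//.
  - exact: mgE.
  - by move=> x _; rewrite lee_fin.
  - by rewrite disj_set2E -setCitvl setICr.
have p_fin : (\int[lebesgue_measure]_(s in `]-oo, b]) (g s)%:E)%E \is a fin_num.
  rewrite ge0_fin_numE; last by apply: integral_ge0 => x _; rewrite lee_fin.
  apply: le_lt_trans (ltry 1); rewrite -g1; apply: ge0_subset_integral => //.
  - exact: mgE.
  - by move=> x _; rewrite lee_fin.
exists (fine (\int[lebesgue_measure]_(s in `]-oo, b]) (g s)%:E)).
rewrite fineK//; split => //.
- by rewrite phiE// [RHS]EFinM [X in _ = (_ * X)%E]fineK.
- rewrite phiE// [RHS]EFinM EFinB [X in (_ - X)%E]fineK//; congr (_ * _)%E.
  by rewrite -g_split addeAC subee// add0e.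
Qed.

(** If the lower tail held at least half of the mass, [median_le] would produce a median at or below
    [b]. *)
Lemma upper_tail_gt (R : realType) (phi : R -> R) (b : R) :
  measurable_fun [set: R] phi -> (forall x, 0 <= phi x) ->
  let c := (\int[lebesgue_measure]_x (phi x)%:E)%E in
  (0 < c < +oo)%E ->
  (forall m, is_median (fun s => phi s / fine c) m -> b < m) ->
  (\int[lebesgue_measure]_(s in `]-oo, b]) (phi s)%:E <
   \int[lebesgue_measure]_(s in `]b, +oo[) (phi s)%:E)%E.
Proof.
move=> mphi phi0 c c_fin med.
have [mg g0 g1 [p [pE -> ->]]] := normalized_tails R phi b mphi phi0 c_fin.
rewrite lte_fin ltr_pM2l ?fine_gt0//.
suff : p < 2^-1 by lra.
rewrite ltNge; apply/negP => p2.
have [|m mb /med] := median_le R _ b mg g0 g1; first by rewrite pE lee_fin.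
by rewrite ltNge mb.
Qed.

Lemma lower_tail_gt (R : realType) (phi : R -> R) (b : R) :
  measurable_fun [set: R] phi -> (forall x, 0 <= phi x) ->
  let c := (\int[lebesgue_measure]_x (phi x)%:E)%E in
  (0 < c < +oo)%E ->
  (forall m, is_median (fun s => phi s / fine c) m -> m < b) ->
  (\int[lebesgue_measure]_(s in `]b, +oo[) (phi s)%:E <
   \int[lebesgue_measure]_(s in `]-oo, b]) (phi s)%:E)%E.
Proof.
move=> mphi phi0 c c_fin med.
have [mg g0 g1 [p [pE -> ->]]] := normalized_tails R phi b mphi phi0 c_fin.
rewrite lte_fin ltr_pM2l ?fine_gt0//.
suff : 2^-1 < p by lra.
rewrite ltNge; apply/negP => p2.
have [|m mb /med] := median_ge R _ b mg g0 g1; first by rewrite pE lee_fin.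
by rewrite ltNge mb.
Qed.

(** * Strict comparison of integrals *)

(** The integrals are finite, so the dichotomy holds almost everywhere and gives [f <= g] there. If
    the integrals agreed, [f = g] almost everywhere, which leaves only the alternative where both
    vanish; their sum would then integrate to 0. *)
Lemma lt_integral (d : measure_display) (T : measurableType d) (R : realType)
    (mu : {measure set T -> \bar R}) (f g : T -> \bar R) :
  measurable_fun [set: T] f -> measurable_fun [set: T] g ->
  (forall x, 0 <= f x)%E -> (forall x, 0 <= g x)%E ->
  (\int[mu]_x f x < +oo)%E -> (\int[mu]_x g x < +oo)%E ->
  (forall x, f x < +oo -> g x < +oo -> f x < g x \/ f x = 0 /\ g x = 0)%E ->
  (0 < \int[mu]_x f x + \int[mu]_x g x)%E ->
  (\int[mu]_x f x < \int[mu]_x g x)%E.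
Proof.
move=> mf mg f0 g0 f_fin g_fin fg fg_gt0.
have intf : mu.-integrable [set: T] f.
  apply/integrableP; split => //.
  by under eq_integral do rewrite gee0_abs//.
have intg : mu.-integrable [set: T] g.
  apply/integrableP; split => //.
  by under eq_integral do rewrite gee0_abs//.
have aef := integrable_ae measurableT intf.
have aeg := integrable_ae measurableT intg.
have ae_fg : {ae mu, forall x, [set: T] x -> f x <= g x}%E.
  move: aef aeg; apply: filterS2 => x /(_ I) fx /(_ I) gx _.
  case: (fg x) => [||/ltW//|[-> ->]//].
  - by rewrite -ge0_fin_numE.
  - by rewrite -ge0_fin_numE.
rewrite lt_neqAle ae_ge0_le_integral// andbT.
apply/eqP => fg_int.
have : ae_eq mu [set: T] (g \- f)%E (cst 0%E).
  apply/ae_eq_integral_abs => //; first exact: emeasurable_funB.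
  rewrite (ae_eq_integral (g \- f)%E)//.
  - rewrite integralB// fg_int subee//.
    by rewrite ge0_fin_numE ?g_fin//; exact: integral_ge0.
  - by apply: measurableT_comp => //; exact: emeasurable_funB.
  - exact: emeasurable_funB.
  move: aef ae_fg; apply: filterS2 => x /(_ I) fx /(_ I) fgx _.
  by rewrite gee0_abs// sube_ge0 ?fx.
move=> ae0.
have : ae_eq mu [set: T] g (cst 0%E).
  move: aef aeg ae0; apply: filterS3 => x /(_ I) fx /(_ I) gx /(_ I) /eqP + _.
  rewrite sube_eq ?fx// add0e => /eqP gfx.
  case: (fg x) => [|||[_ ->]//].
  - by rewrite -ge0_fin_numE.
  - by rewrite -ge0_fin_numE.
  - by rewrite gfx ltxx.
move=> /(ae_eq_integral _) => /(_ measurableT mg (measurable_cst _)).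
by rewrite integral0 => g_eq0; rewrite fg_int g_eq0 adde0 ltxx in fg_gt0.
Qed.

(** * Half-lines on which one estimate beats another *)

(** Beyond [q] both errors are positive and [s - q] is the smaller. Just below [q] the error [s - q]
    is close to 0 while [s - p] stays away from it. The gain is that [b] lies strictly below [q],
    hence below a median equal to [q]. *)
Lemma bowl_shaped_lt_right (R : realType) (W : R -> R) (p q : R) :
  bowl_shaped W -> cvg (W x @[x --> (0 : R)^']) -> p < q ->
  exists2 b, b < q & forall s, b < s -> W (s - q) < W (s - p).
Proof.
move=> bW cW pq; have [_ _ _ Wpos] := bW.
have [|e e0 We] := bowl_shaped_near0 R W ((q - p) / 2) bW cW.
  by rewrite gt_eqF//; lra.
(* For [s] between [b] and [q], the bound [e] makes [W (s - q)] less than [W ((q - p) / 2)], and the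
   bound [(q - p) / 2] keeps [s - p] above [(q - p) / 2]. *)
exists (q - Num.min e ((q - p) / 2)).
  by rewrite gtrBl lt_min e0/=; lra.
move=> s; rewrite ltrBlDr -ltrBlDl => qs.
have [qs0|sq] := ltP q s; first by apply: Wpos; lra.
move: qs; rewrite lt_min => /andP[qse qsp].
apply: (@lt_trans _ _ (W ((q - p) / 2))); last by apply: Wpos; lra.
by apply: We; rewrite ler0_norm ?subr_le0// opprB.
Qed.

Lemma bowl_shaped_lt_left (R : realType) (W : R -> R) (p q : R) :
  bowl_shaped W -> cvg (W x @[x --> (0 : R)^']) -> q < p ->
  exists2 b, q < b & forall s, s <= b -> W (s - q) < W (s - p).
Proof.
move=> bW cW qp; have [_ _ Wneg _] := bW.
have [|e e0 We] := bowl_shaped_near0 R W ((q - p) / 2) bW cW.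
  by rewrite lt_eqF//; lra.
(* The half-line [s <= b] is closed here, so the minimum is halved once more to keep [s - q]
   strictly below it. *)
exists (q + Num.min e ((p - q) / 2) / 2).
  by rewrite ltrDl divr_gt0// lt_min e0/=; lra.
move=> s sb.
have m0 : 0 < Num.min e ((p - q) / 2) by rewrite lt_min e0/=; lra.
have : s - q < Num.min e ((p - q) / 2) by lra.
rewrite lt_min => /andP[sqe sqp].
have [sq0|qs] := ltP s q; first by apply: Wneg; lra.
apply: (@lt_trans _ _ (W ((q - p) / 2))); last by apply: Wneg; lra.
by apply: We; rewrite ger0_norm ?subr_ge0.
Qed.

(** * The joint law of D and X2 - theta2 *)

Lemma measurable_joint_density (R : realType) (f : R * R -> R) (lam : R) :
  measurable_fun [set: R * R] f ->
  measurable_fun [set: R * R] (fun z => f (z.2 - z.1 + lam, z.2)).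
Proof.
move=> mf; apply: measurableT_comp => //; apply/measurable_fun_pair => //=.
by apply: measurable_funD => //; exact: measurable_funB.
Qed.

Lemma measurable_D (R : realType) : measurable_fun [set: R * R] (@D R).
Proof. exact: measurable_funB. Qed.

(** The shear by theta2 turns the arguments of [f] into [s + th.2 - t - th.1] and [s], so this law
    depends on [th] only through the difference of its coordinates. *)
Lemma location_model_coord (R : realType) (f : R * R -> R)
    (d : measure_display) (T : measurableType d)
    (P : R * R -> probability T R) (X : T -> R * R) (th : R * R)
    (B : set (R * R)) :
  is_pdf2 f -> location_model f P X -> Theta0 th -> measurable B ->
  P th ((fun w => (D (X w), (X w).2 - th.2)) @^-1` B) =
  (\int[lebesgue_measure]_t \int[lebesgue_measure]_s
     ((fun z => (f (z.2 - z.1 + (th.2 - th.1), z.2))%:E) \_ B) (t, s))%E.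
Proof.
move=> [mf f0 _] [mX HX] th0 mB.
pose C : set (R * R) := (fun x => (D x, x.2 - th.2)) @^-1` B.
have mC : measurable C.
  rewrite -[C]setTI; have : measurable_fun [set: R * R]
      (fun x : R * R => (D x, x.2 - th.2)).
    apply/measurable_fun_pair => /=; first exact: measurable_D.
    exact: measurable_funB.
  by apply.
have -> : (fun w => (D (X w), (X w).2 - th.2)) @^-1` B = X @^-1` C.
  by apply/seteqP; split.
rewrite (HX th th0 C mC).
rewrite (ge0_integral_shear R th.2 C
  (fun x => (f (x.1 - th.1, x.2 - th.2))%:E)); first last.
- by move=> x; rewrite lee_fin.
- apply/measurable_EFinP; apply: measurableT_comp => //.
  by apply/measurable_fun_pair => /=; exact: measurable_funB.
- exact: mC.
- apply: eq_integral => t _; apply: eq_integral => s _.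
  rewrite !patchE.
  have -> : ((s + th.2 - t, s + th.2) \in C) = ((t, s) \in B).
    apply/idP/idP; rewrite !inE /C/= /D/=.
    + by rewrite addrK opprB addrCA subrr addr0.
    + by rewrite addrK opprB addrCA subrr addr0.
  case: ifP => // _; congr (f (_, _))%:E => /=; ring.
Qed.

(** * Conditional comparison for a fixed value of D *)

(** Here [phi] is the unnormalised conditional density, [p] the old shift and [q] the new one. The
    set where [q] wins contains a half-line with more than half of the mass, because its endpoint
    lies strictly on the far side of [q] from every median; the set where [q] does not win lies in
    the other half-line. *)
Lemma closer_mass_lt (R : realType) (W phi : R -> R) (p q : R) :
  bowl_shaped W -> cvg (W x @[x --> (0 : R)^']) ->
  measurable_fun [set: R] phi -> (forall x, 0 <= phi x) ->
  let c := (\int[lebesgue_measure]_x (phi x)%:E)%E in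
  (0 < c < +oo)%E -> q != p ->
  (forall m, is_median (fun s => phi s / fine c) m ->
    if p < q then q <= m else m <= q) ->
  (\int[lebesgue_measure]_(s in [set s | ~~ (W (s - q) < W (s - p))%R])
      (phi s)%:E <
   \int[lebesgue_measure]_(s in [set s | (W (s - q) < W (s - p))%R])
      (phi s)%:E)%E.
Proof.
move=> bW cW mphi phi0 c c_fin qp med.
have mphiE (A : set R) : measurable_fun A (EFin \o phi).
  by apply/measurable_EFinP; apply: measurable_funS mphi.
have mW (r : R) : measurable_fun [set: R] (fun s => W (s - r)).
  apply: measurableT_comp; first exact: bowl_shaped_measurable.
  exact: measurable_funB.
have m_lt : measurable_fun [set: R] (fun s => W (s - q) < W (s - p)).
  by apply: measurable_fun_ltr; exact: mW.
have m1 : measurable [set s | W (s - q) < W (s - p)].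
  by rewrite -[X in measurable X]setTI; exact: (m_lt _ [set true]).
have m_ge := measurable_neg m_lt.
have m2 : measurable [set s | ~~ (W (s - q) < W (s - p))].
  by rewrite -[X in measurable X]setTI; exact: (m_ge _ [set true]).
have sub (A B : set R) : measurable A -> measurable B -> A `<=` B ->
    (\int[lebesgue_measure]_(s in A) (phi s)%:E <=
     \int[lebesgue_measure]_(s in B) (phi s)%:E)%E.
  move=> mA mB AB; apply: ge0_subset_integral => //; first exact: mphiE.
  by move=> x _; rewrite lee_fin.
case: ltP med => [pq|qp'] med.
- have [b bq Wb] := bowl_shaped_lt_right R W p q bW cW pq.
  apply: le_lt_trans (lt_le_trans (upper_tail_gt R phi b mphi phi0 c_fin _) _).
  + apply: sub => // s /=; rewrite in_itv/= leNgt; apply: contra; exact: Wb.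
  + by move=> m /med; exact: lt_le_trans.
  + by apply: sub => // s /=; rewrite in_itv/= andbT; exact: Wb.
- have {}qp' : q < p by rewrite lt_neqAle qp.
  have [b qb Wb] := bowl_shaped_lt_left R W p q bW cW qp'.
  apply: le_lt_trans (lt_le_trans (lower_tail_gt R phi b mphi phi0 c_fin _) _).
  + apply: sub => // s /=; rewrite in_itv/= andbT [b < s]ltNge; apply: contra.
    exact: Wb.
  + by move=> m /med mq; exact: le_lt_trans mq qb.
  + by apply: sub => // s /=; rewrite in_itv/=; exact: Wb.
Qed.

Theorem corollary3p2p1 (R : realType) (f : R * R -> R) (Hf : is_pdf2 f)
    (d : measure_display) (T : measurableType d)
    (P : R * R -> probability T R) (X : T -> R * R)
    (HX : location_model f P X)
    (W : R -> R) (HW : bowl_shaped W)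
    (* Not in the original wording, which is false without it: the one-sided
       limits of W at 0 agree (W need not be continuous at 0) *)
    (HW0 : cvg (W x @[x --> (0 : R)^']))
    (l u : R -> \bar R) (Hlu : median_bounds f l u)
    (psi : R -> R) (Hpsi : measurable_fun [set: R] psi)
    (Hlt1 : forall th, Theta0 th ->
      (P th [set w | l (D (X w)) <= (psi (D (X w)))%:E <= u (D (X w))] < 1)%E)
    (psi0 : R -> R) (Hpsi0 : measurable_fun [set: R] psi0)
    (Hlow : forall t, ((psi t)%:E < l t)%E ->
      psi t < psi0 t /\ ((psi0 t)%:E <= l t)%E)
    (Hupp : forall t, (u t < (psi t)%:E)%E ->
      (u t <= (psi0 t)%:E)%E /\ psi0 t < psi t)
    (Hmid : forall t, (l t <= (psi t)%:E <= u t)%E -> psi0 t = psi t) :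
  forall th, Theta0 th ->
    ((2^-1)%:E < GPN W P X (equivariant_est psi0) (equivariant_est psi) th)%E.
Proof.
move=> th th0.
have [mf f0 _] := Hf.
have mX := HX.1.
set lam := th.2 - th.1.
have lam0 : 0 <= lam by rewrite subr_ge0.
pose h (z : R * R) := f (z.2 - z.1 + lam, z.2).
have mh : measurable_fun [set: R * R] h by exact: measurable_joint_density.
pose Y w := (D (X w), (X w).2 - th.2).
have mY : measurable_fun [set: T] Y.
  apply/measurable_fun_pair => /=.
    by apply: measurableT_comp => //; exact: measurable_D.
  by apply: measurable_funB => //; exact: measurableT_comp.
pose loss_lt (z : R * R) := W (z.2 - psi0 z.1) < W (z.2 - psi z.1).
(* [B0], [B1] and [B2] partition the plane. Ties in loss between distinct estimates go to [B2], that
   is, against [psi0]; the resulting lower bound on [GPN] still suffices. *)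
pose B0 : set (R * R) := [set z | psi0 z.1 == psi z.1].
pose B1 : set (R * R) := [set z | (psi0 z.1 != psi z.1) && loss_lt z].
pose B2 : set (R * R) := [set z | (psi0 z.1 != psi z.1) && ~~ loss_lt z].
have mloss (q : R -> R) : measurable_fun [set: R] q ->
    measurable_fun [set: R * R] (fun z => W (z.2 - q z.1)).
  move=> mq; apply: measurableT_comp; first exact: bowl_shaped_measurable.
  by apply: measurable_funB => //; exact: measurableT_comp.
have msetb (b : R * R -> bool) : measurable_fun [set: R * R] b ->
    measurable [set z | b z].
  by move=> mb; rewrite -[X in measurable X]setTI; exact: (mb _ [set true]).
have m_eq : measurable_fun [set: R * R] (fun z => psi0 z.1 == psi z.1).
  by apply: measurable_fun_eqr; exact: measurableT_comp.
have m_lt : measurable_fun [set: R * R] loss_lt.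
  by apply: measurable_fun_ltr; exact: mloss.
have mB0 : measurable B0 by exact: msetb.
have mB1 : measurable B1.
  by apply: msetb; apply: measurable_and => //; exact: measurable_neg.
have mB2 : measurable B2.
  by apply: msetb; apply: measurable_and; exact: measurable_neg.
have mpre (B : set (R * R)) : measurable B -> measurable (Y @^-1` B).
  by move=> mB; rewrite -[X in measurable X]setTI; exact: mY.
have PE (B : set (R * R)) : measurable B -> P th (Y @^-1` B) =
    (\int[lebesgue_measure]_t \int[lebesgue_measure]_s
      ((EFin \o h) \_ B) (t, s))%E.
  by move=> mB; exact: (location_model_coord R f d T P X th B Hf HX th0 mB).
(* Unnormalised conditional probability of [B] given [D = t]. *)
pose G B t := (\int[lebesgue_measure]_s ((EFin \o h) \_ B) (t, s))%E.
have hB0 (B : set (R * R)) z : (0 <= ((EFin \o h) \_ B) z)%E.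
  by rewrite patchE; case: ifP => // _; rewrite lee_fin; exact: f0.
have G0 B t : (0 <= G B t)%E by exact: integral_ge0.
have mhB (B : set (R * R)) : measurable B ->
    measurable_fun [set: R * R] ((EFin \o h) \_ B).
  move=> mB; apply/(measurable_restrictT _ mB); apply: measurable_funTS.
  exact/measurable_EFinP.
have mG (B : set (R * R)) : measurable B -> measurable_fun [set: R] (G B).
  by move=> mB; apply: measurable_integral_snd => //; exact: mhB.
have G_fin (B : set (R * R)) : measurable B ->
    (\int[lebesgue_measure]_t G B t < +oo)%E.
  move=> mB; rewrite -PE//; apply: le_lt_trans (ltry 1).
  by apply: probability_le1; exact: mpre.
have mhs t : measurable_fun [set: R] (fun s => h (t, s)).
  by apply: measurableT_comp => //; exact: measurable_fun_pair.
have G_out B t : (forall s, ~ B (t, s)) -> G B t = 0%E.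
  move=> Bt; rewrite /G integral0_eq// => s _.
  by rewrite patchE memNset.
have G_in (B : set (R * R)) t : G B t =
    (\int[lebesgue_measure]_(s in [set s | B (t, s)]) (h (t, s))%:E)%E.
  rewrite [RHS]integral_mkcond; apply: eq_integral => s _.
  by rewrite !patchE; congr (if _ then _ else _); apply/idP/idP; rewrite !inE.
have G_add t : psi0 t != psi t -> (G B1 t + G B2 t)%E = pdfD f lam t.
  move=> pt; rewrite -ge0_integralD//.
  - apply: eq_integral => s _; rewrite !patchE.
    have -> : ((t, s) \in B1) = loss_lt (t, s).
      by apply/idP/idP; rewrite inE /B1/= pt.
    have -> : ((t, s) \in B2) = ~~ loss_lt (t, s).
      by apply/idP/idP; rewrite inE /B2/= pt.
    by case: (loss_lt _); rewrite ?adde0 ?add0e.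
  - apply: (measurableT_comp (mhB _ mB1)); exact: measurable_fun_pair.
  - apply: (measurableT_comp (mhB _ mB2)); exact: measurable_fun_pair.
(* [l] and [u] need not be measurable, but the event on which [psi] respects
   the bounds is [psi0 = psi], which is. *)
have mid_iff t : (l t <= (psi t)%:E <= u t)%E = (psi0 t == psi t).
  apply/idP/eqP => [/Hmid//|pt]; rewrite !leNgt; apply/andP; split.
  - by apply/negP => /Hlow[]; rewrite pt ltxx.
  - by apply/negP => /Hupp[_]; rewrite pt ltxx.
(* Where the shifts differ, [psi0 t] has moved from [psi t] towards the medians without passing any
   of them. *)
have med_side t : psi0 t != psi t -> forall m, suppD f lam t ->
    is_median (cond_pdf f lam t) m ->
    if psi t < psi0 t then psi0 t <= m else m <= psi0 t.
  move=> pt m tD /(Hlu lam t m lam0 tD)/andP[lm mu].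
  move: pt; rewrite -mid_iff negb_and -!ltNge => /orP[/Hlow[-> lt]|/Hupp[ut pt]].
  - by rewrite -lee_fin; exact: le_trans lt lm.
  - by rewrite ltNge (ltW pt)/= -lee_fin; exact: le_trans mu ut.
have P0_lt1 : (P th (Y @^-1` B0) < 1)%E.
  rewrite (_ : Y @^-1` B0 =
      [set w | l (D (X w)) <= (psi (D (X w)))%:E <= u (D (X w))]%E).
    exact: Hlt1.
  by apply/seteqP; split => w /=; rewrite mid_iff.
have P_split : (P th (Y @^-1` B2) + P th (Y @^-1` B1) =
    1 - P th (Y @^-1` B0))%E.
  rewrite -(probability_setC _ (mpre _ mB0)).
  rewrite -measureU; [|exact: mpre|exact: mpre|].
  - congr (P th _); apply/seteqP; split => w /=; rewrite /B0 /B1 /B2/=.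
      by case=> /andP[/negP].
    by move=> /negP ->; case: (loss_lt _); [right|left].
  - rewrite -subset0 => w /=; rewrite /B1 /B2/=.
    by case=> /andP[_ /negP + /andP[]].
have P_lt : (P th (Y @^-1` B2) < P th (Y @^-1` B1))%E.
  rewrite !PE//; apply: lt_integral.
  - exact: mG.
  - exact: mG.
  - exact: G0.
  - exact: G0.
  - exact: G_fin.
  - exact: G_fin.
  (* If the shifts agree at [t], both sections are empty; if the density of D vanishes there, both
     masses are 0. Otherwise finiteness of the two masses excludes the value [+oo] of that density,
     so [t] is in [suppD] and the conditional comparison applies. *)
  - move=> t G2 G1; have [pt|pt] := eqVneq (psi0 t) (psi t).
      by right; split; apply: G_out => s; rewrite /B1 /B2/= pt eqxx.
    have := G_add t pt; have [c0 cE|c_neq0 cE] := eqVneq (pdfD f lam t) 0%E.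
      right; move: cE; rewrite c0 => /eqP; rewrite padde_eq0//.
      by move=> /andP[/eqP G10 /eqP G20]; split; [exact: G20|exact: G10].
    have c_fin : (0 < pdfD f lam t < +oo)%E.
      rewrite lt0e c_neq0 -cE lte_add_pinfty// andbT adde_ge0//.
    left; rewrite -!/(G _ _) !G_in /B1 /B2/= pt/=.
    exact: (closer_mass_lt R W _ (psi t) (psi0 t) HW HW0 (mhs t)
      (fun s => f0 _) c_fin pt (fun m => med_side t pt m c_fin)).
  - by rewrite -!PE// P_split sube_gt0.
have lossE (q : R -> R) w :
    L2 W th (equivariant_est q (X w)) = W ((Y w).2 - q (Y w).1).
  by rewrite /L2 /equivariant_est addrAC.
(* Only an inequality: distinct estimates on either side of theta2 may have equal losses, so the tie
   event can exceed the preimage of [B0]. *)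
have GPN_ge : (P th (Y @^-1` B1) + (2^-1)%:E * P th (Y @^-1` B0) <=
    GPN W P X (equivariant_est psi0) (equivariant_est psi) th)%E.
  have m_le (A B : set T) : measurable A -> measurable B -> A `<=` B ->
      (P th A <= P th B)%E.
    by move=> mA mB AB; apply: le_measure => //; rewrite inE.
  rewrite /GPN; apply: leeD; last rewrite lee_pmul2l ?lte_fin//.
  - apply: m_le; first exact: mpre.
      rewrite (_ : [set w | _] = Y @^-1` [set z | loss_lt z]).
        by apply: mpre; exact: msetb.
      by apply/seteqP; split => w /=; rewrite !lossE.
    by move=> w /=; rewrite !lossE => /andP[].
  - apply: m_le; first exact: mpre.
      rewrite (_ : [set w | _] =
          Y @^-1` [set z | W (z.2 - psi0 z.1) == W (z.2 - psi z.1)]).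
        by apply: mpre; apply: msetb; apply: measurable_fun_eqr; exact: mloss.
      by apply/seteqP; split => w /=; rewrite !lossE => /eqP.
    by move=> w /= /eqP pw; rewrite !lossE pw.
apply: lt_le_trans GPN_ge.
have fin (B : set (R * R)) : measurable B ->
    exists r : R, P th (Y @^-1` B) = r%:E.
  move=> mB; exists (fine (P th (Y @^-1` B))); rewrite fineK//.
  by apply: fin_num_measure; exact: mpre.
have [[p0 E0] [[p1 E1] [p2 E2]]] := (fin _ mB0, (fin _ mB1, fin _ mB2)).
(* From [p2 < p1] and [p0 + p1 + p2 = 1] follows [2 p1 + p0 > 1], which is the claim after
   halving. *)
move: P_lt P_split; rewrite E0 E1 E2 -EFinD -EFinB lte_fin => p21 [p_sum].
by rewrite -EFinM -EFinD lte_fin; lra.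
Qed.
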